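(* For $k\geq 1$ write $\xi_k(t)=\sum_{i=0}^{k-1}(-t)^i$. The following quandle cohomology groups $H^m_{\rm Q}(X;X)$ of Alexander quandles $X$, with coefficients in (the additive group of) $X$, are non-trivial ($\neq 0$): (1) $X=\mathbb{Z}_2[t,t^{-1}]/(\xi_{2^n+1}(t))$, for any positive integer $n$, and for $m=2,3$. (2) $X=\mathbb{Z}_p[t,t^{-1}]/(\xi_{(p^n+1)/2}(t))$, for any odd prime $p$ and for any positive integer $n$, and for $m=2,3$. (3) $X=\mathbb{Z}_p[t,t^{-1}]/(t-n(1-t)^2)$, for $m=3$, and for: (a) $p=3$, $n\equiv 1,2 \pmod 3$; (b) $p=5$, $n\equiv 1,3$, and $4\pmod 5$; (c) $p=7$, all $n$ except $n\equiv 2,6\pmod 7$; (d) $p=11$, all $n$ except $n\equiv 1,2,6$, and $9\pmod{11}$; (e) $p=13$, all $n$ except $n\equiv 2,4,6,7$, and $12\pmod{13}$.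
   Context: $\mathbb{Z}_p=\mathbb{Z}/p\mathbb{Z}$; in (3), $n$ denotes an integer. A quandle is a set $X$ with a binary operation $*$ such that $a*a=a$; for all $a,b$ there is a unique $c$ with $a=c*b$; and $(a*b)*c=(a*c)*(b*c)$. Any $\mathbb{Z}[t,t^{-1}]$-module $M$ is a quandle (Alexander quandle) under $a*b=ta+(1-t)b$. Quandle cohomology: for a quandle $X$ let $C_n^R(X)$ be the free abelian group on $X^n$, with boundary $$\partial_n(x_1,\ldots,x_n)=\sum_{i=2}^n(-1)^i\big[(x_1,\ldots,x_{i-1},x_{i+1},\ldots,x_n)-(x_1*x_i,\ldots,x_{i-1}*x_i,x_{i+1},\ldots,x_n)\big]$$ for $n\ge 2$ and $\partial_n=0$ for $n\le 1$. Let $C_n^D(X)\subset C_n^R(X)$ be the subgroup generated by tuples with $x_i=x_{i+1}$ for some $i\in\{1,\ldots,n-1\}$ if $n\geq 2$, and $C_n^D(X)=0$ otherwise; it is a subcomplex. Set $C_n^Q(X)=C_n^R(X)/C_n^D(X)$ with the induced boundary. For an abelian group $A$, $C_Q^n(X;A)=\mathrm{Hom}(C_n^Q(X),A)$ with coboundary $\delta f=f\circ\partial$, and $H^n_{\rm Q}(X;A)$ is the $n$-th cohomology group of this cochain complex.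
   Formalization: In (3)(c), (d), (e) the case n ≡ 0 (mod p) is excluded: there t − n(1−t)² = t is a unit, so X = 0 and H³_Q(X;X) = 0, and the claim as written is false. *)

(* Defs.v *)
From HB Require Import structures.
From mathcomp Require Import all_boot all_order all_algebra.
From mathcomp Require Import generic_quotient ring_quotient fraction.
From mathcomp Require Import boolp classical_sets functions.
From mathcomp.multinomials Require Import freeg.
From mathcomp Require Import zify.

Set Implicit Arguments.
Unset Strict Implicit.
Unset Printing Implicit Defensive.

Import GRing.Theory.
Local Open Scope ring_scope.
Local Open Scope quotient_scope.

HB.mixin Record isQuandle X of Choice X := {
  qop : X -> X -> X;
  qop_idem : forall a, qop a a = a;
  qop_div : forall a b, exists! c, a = qop c b;
  qop_distr : forall a b c, qop (qop a b) c = qop (qop a c) (qop b c)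
}.

#[short(type="quandleType")]
HB.structure Definition Quandle := {X of isQuandle X & Choice X}.

(* R[t, t^-1], as the subring of R(t) of fractions with denominator a power   *)
(* of t.                                                                      *)
Section Laurent.
Variable R : idomainType.

Let T : {fraction {poly R}} := tofrac 'X.

Definition is_laurent : {pred {fraction {poly R}}} :=
  fun f => `[< exists (p : {poly R}) (k : nat), f = tofrac p / T ^+ k >].

Let T_neq0 : T != 0.
Proof. by rewrite tofrac_eq0 polyX_eq0. Qed.

Lemma is_laurent_subring : subring_closed is_laurent.
Proof.
split=> [|f g /asboolP[p [k ->]] /asboolP[q [l ->]]|
          f g /asboolP[p [k ->]] /asboolP[q [l ->]]].
- by apply/asboolP; exists 1, 0%N; rewrite expr0 divr1 rmorph1.
- apply/asboolP; exists (p * 'X^l - q * 'X^k), (k + l)%N.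
  rewrite rmorphB !rmorphM !rmorphXn exprD -/T.
  by rewrite -(mulNr (tofrac q)) addf_div ?expf_neq0 ?mulNr.
- apply/asboolP; exists (p * q), (k + l)%N.
  by rewrite rmorphM exprD mulf_div.
Qed.

HB.instance Definition _ :=
  GRing.isSubringClosed.Build {fraction {poly R}} is_laurent is_laurent_subring.

Record laurent := Laurent { laurent_val; _ : laurent_val \in is_laurent }.

HB.instance Definition _ := [isSub for laurent_val].
HB.instance Definition _ := [Choice of laurent by <:].
HB.instance Definition _ := [SubChoice_isSubComNzRing of laurent by <:].

Lemma is_laurent_t : T \in is_laurent.
Proof. by apply/asboolP; exists 'X, 0%N; rewrite expr0 divr1. Qed.

Lemma is_laurent_tV : T^-1 \in is_laurent.
Proof. by apply/asboolP; exists 1, 1%N; rewrite rmorph1 div1r expr1. Qed.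

Definition laurent_t : laurent := Laurent is_laurent_t.
Definition laurent_tV : laurent := Laurent is_laurent_tV.

Lemma laurent_t_mulV : laurent_t * laurent_tV = 1.
Proof. by apply: val_inj; rewrite /= mulfV. Qed.

End Laurent.

Arguments laurent_t {R}.
Arguments laurent_tV {R}.

(* For R = int these are the modules over Z[t, t^-1]; a module over           *)
(* R[t, t^-1] is one over Z[t, t^-1] by restriction of scalars, with the same *)
(* action of t.                                                               *)
Section Alexander.
Variables (R : idomainType) (M : lmodType (laurent R)).

Definition alexander : Type := M.

HB.instance Definition _ := Choice.on alexander.

Definition alexander_op (a b : alexander) : alexander :=
  laurent_t *: (a : M) + (1 - laurent_t) *: (b : M).

Lemma alexander_idem a : alexander_op a a = a.
Proof. by rewrite /alexander_op -scalerDl addrC subrK scale1r. Qed.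

Lemma alexander_div a b : exists! c, a = alexander_op c b.
Proof.
exists (laurent_tV *: ((a : M) - (1 - laurent_t) *: (b : M))); split.
  by rewrite /alexander_op scalerA laurent_t_mulV scale1r subrK.
move=> c ->; rewrite /alexander_op addrK scalerA mulrC laurent_t_mulV.
exact: scale1r.
Qed.

Lemma alexander_distr a b c :
  alexander_op (alexander_op a b) c =
  alexander_op (alexander_op a c) (alexander_op b c).
Proof.
rewrite /alexander_op !scalerDr !scalerA -!addrA; congr (_ + _).
rewrite addrCA [(1 - laurent_t) * laurent_t]mulrC; congr (_ + _).
rewrite -scalerDl.
by rewrite -mulrDl (addrC laurent_t) subrK mul1r.
Qed.

HB.instance Definition _ := isQuandle.Build alexander
  alexander_idem alexander_div alexander_distr.

End Alexander.

(* The quotient R[t, t^-1] / (h), as a module over R[t, t^-1]. The library's  *)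
(* ring quotients require h not to be a unit, hence the module structure.     *)
Section LaurentQuotient.
Variables (R : idomainType) (h : laurent R).

Definition pideal : {pred laurent R} := fun f => `[< exists g, f = g * h >].

Lemma pideal_zmod : zmod_closed pideal.
Proof.
split=> [|f g /asboolP[a ->] /asboolP[b ->]]; apply/asboolP.
  by exists 0; rewrite mul0r.
by exists (a - b); rewrite mulrBl.
Qed.

Lemma pidealM a f : f \in pideal -> a * f \in pideal.
Proof.
by move=> /asboolP[g ->]; apply/asboolP; exists (a * g); rewrite mulrA.
Qed.

HB.instance Definition _ :=
  GRing.isZmodClosed.Build (laurent R) pideal pideal_zmod.

Definition laurent_quot := Quotient.quot pideal.

HB.instance Definition _ := GRing.Zmodule.on laurent_quot.

Definition laurent_pi (f : laurent R) : laurent_quot :=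
  \pi_(Quotient.quot pideal) f.

Definition laurent_scale (a : laurent R) (x : laurent_quot) : laurent_quot :=
  laurent_pi (a * repr (x : Quotient.quot pideal)).

Lemma laurent_piD : {morph laurent_pi : f g / f + g}.
Proof. by move=> f g; exact: Quotient.pi_add. Qed.

Lemma laurent_pi_surj x : exists f, x = laurent_pi f.
Proof.
by exists (repr (x : Quotient.quot pideal)); rewrite /laurent_pi reprK.
Qed.

Lemma laurent_pi_eq f g : f - g \in pideal -> laurent_pi f = laurent_pi g.
Proof. by move=> fg; apply/eqP; rewrite -Quotient.idealrBE. Qed.

Lemma laurent_scaleE a f : laurent_scale a (laurent_pi f) = laurent_pi (a * f).
Proof.
apply: laurent_pi_eq; rewrite -mulrBr; apply: pidealM.
by rewrite Quotient.idealrBE reprK.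
Qed.

Lemma laurent_scaleA a b x :
  laurent_scale a (laurent_scale b x) = laurent_scale (a * b) x.
Proof. by have [f ->] := laurent_pi_surj x; rewrite !laurent_scaleE mulrA. Qed.

Lemma laurent_scale1 : left_id 1 laurent_scale.
Proof.
by move=> x; have [f ->] := laurent_pi_surj x; rewrite laurent_scaleE mul1r.
Qed.

Lemma laurent_scaleDr : right_distributive laurent_scale +%R.
Proof.
move=> a x y; have [f ->] := laurent_pi_surj x.
have [g ->] := laurent_pi_surj y.
by rewrite -laurent_piD !laurent_scaleE mulrDr laurent_piD.
Qed.

Lemma laurent_scaleDl x : {morph laurent_scale^~ x : a b / a + b}.
Proof.
move=> a b; have [f ->] := laurent_pi_surj x.
by rewrite !laurent_scaleE mulrDl laurent_piD.
Qed.

HB.instance Definition _ := GRing.Zmodule_isLmodule.Build (laurent R)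
  laurent_quot laurent_scaleA laurent_scale1 laurent_scaleDr laurent_scaleDl.

End LaurentQuotient.

Section Chains.
Variable X : quandleType.

(* C_n^R(X) *)
Definition rack_chain n : lmodType int := {freeg (n.-tuple X) / int}.

Definition face0 n (i : 'I_n.+1) (x : n.+1.-tuple X) : n.-tuple X :=
  [tuple tnth x (fintype.lift i j) | j < n].

Definition face1 n (i : 'I_n.+1) (x : n.+1.-tuple X) : n.-tuple X :=
  [tuple let y := tnth x (fintype.lift i j) in
         if (j < i)%N then qop y (tnth x i) else y | j < n].

(* Indices start at 0, so the sign of the i-th term is (-1) ^ (i + 1) and the *)
(* sum starts at i = 1. The boundary C_{n+1} -> C_n is zero for n = 0.        *)
Definition gen_boundary n (x : n.+1.-tuple X) : rack_chain n :=
  \sum_(i < n.+1 | (0 < i)%N)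
     (-1) ^+ i.+1 *: (<< face0 i x >> - << face1 i x >>).

Definition rack_boundary n : rack_chain n.+1 -> rack_chain n :=
  fglift (@gen_boundary n).

HB.instance Definition _ n := GRing.isZmodMorphism.Build
  (rack_chain n.+1) (rack_chain n) (@rack_boundary n)
  (lift_is_additive (@gen_boundary n)).

Definition degenerate n (x : n.-tuple X) : bool :=
  [exists i : 'I_n, exists j : 'I_n,
     (j == i.+1 :> nat) && (tnth x i == tnth x j)].

(* C_n^D(X) *)
Definition degen_chain n : {pred rack_chain n} :=
  fun c => `[< exists2 s : seq (int * n.-tuple X),
     all (fun u => degenerate u.2) s & c = \sum_(u <- s) u.1 *: << u.2 >> >].

Lemma degen_chain_zmod n : zmod_closed (@degen_chain n).
Proof.
split=> [|c d /asboolP[s sD ->] /asboolP[r rD ->]]; apply/asboolP.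
  by exists [::]; rewrite ?big_nil.
exists (s ++ [seq (- u.1, u.2) | u <- r]).
  by rewrite all_cat sD all_map.
rewrite big_cat big_map /= -sumrN; congr (_ + _).
by apply: eq_bigr => u _; rewrite scaleNr.
Qed.

HB.instance Definition _ n :=
  GRing.isZmodClosed.Build (rack_chain n) (@degen_chain n)
    (@degen_chain_zmod n).

Lemma degen_chainZ n (k : int) c :
  c \in @degen_chain n -> k *: c \in @degen_chain n.
Proof.
move=> /asboolP[s sD ->]; apply/asboolP.
exists [seq (k * u.1, u.2) | u <- s]; first by rewrite all_map.
by rewrite big_map scaler_sumr; apply: eq_bigr => u _; rewrite scalerA.
Qed.

Lemma degen_chain1 n (x : n.-tuple X) :
  degenerate x -> << x >> \in @degen_chain n.
Proof.
move=> xD; apply/asboolP; exists [:: (1, x)]; first by rewrite /= xD.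
by rewrite big_seq1 scale1r.
Qed.

Lemma rack_boundaryU n (x : n.+1.-tuple X) :
  rack_boundary << x >> = gen_boundary x.
Proof. by rewrite /rack_boundary liftU scale1r. Qed.

Lemma rack_boundaryZ n (k : int) (c : rack_chain n.+1) :
  rack_boundary (k *: c) = k *: rack_boundary c.
Proof. by rewrite -[k]intz !scaler_int raddfMz. Qed.

Lemma face01_ord0 n (x : n.+1.-tuple X) : face0 ord0 x = face1 ord0 x.
Proof. by apply: eq_from_tnth => j; rewrite !tnth_mktuple. Qed.

Lemma degenerate_face n (x : n.+1.-tuple X) (k l i : 'I_n.+1) :
  l = k.+1 :> nat -> tnth x k = tnth x l -> i != k -> i != l ->
  degenerate (face0 i x) /\ degenerate (face1 i x).
Proof.
move=> lk xkl ik il.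
have [k' Ek _] := unlift_some ik; have [l' El _] := unlift_some il.
have nk : k = ((i <= k') + k')%N :> nat by rewrite Ek.
have nl : l = ((i <= l') + l')%N :> nat by rewrite El.
have nik : nat_of_ord i <> k by move/val_inj/eqP; rewrite (negbTE ik).
have nil : nat_of_ord i <> l by move/val_inj/eqP; rewrite (negbTE il).
have lk' : l' = k'.+1 :> nat by lia.
have lti : (l' < i)%N = (k' < i)%N by lia.
split; apply/existsP; exists k'; apply/existsP; exists l';
  by rewrite lk' eqxx !tnth_mktuple /= -?Ek -?El xkl -?lti // lk' eqxx.
Qed.

Lemma face_adjacent n (x : n.+1.-tuple X) (k l : 'I_n.+1) :
  l = k.+1 :> nat -> tnth x k = tnth x l ->
  face0 k x = face0 l x /\ face1 k x = face1 l x.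
Proof.
move=> lk xkl.
have kE (j : 'I_n) : j = k :> nat -> fintype.lift k j = l.
  by move=> jk; apply: val_inj; rewrite /= /bump; lia.
have lE (j : 'I_n) : j = k :> nat -> fintype.lift l j = k.
  by move=> jk; apply: val_inj; rewrite /= /bump; lia.
have E (j : 'I_n) : tnth x (fintype.lift k j) = tnth x (fintype.lift l j).
  case: (ltngtP j k) => [jk|kj|jk]; last by rewrite kE // lE.
  - by congr (tnth x _); apply: val_inj; rewrite /= /bump; lia.
  - by congr (tnth x _); apply: val_inj; rewrite /= /bump; lia.
split; apply: eq_from_tnth => j; rewrite !tnth_mktuple E // -xkl.
case: ltngtP => [jk|kj|jk].
- by have -> : (j < l)%N by lia.
- by have -> : (j < l)%N = false by lia.
- have -> : (j < l)%N by lia.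
  by rewrite /= lE // qop_idem.
Qed.

Lemma gen_boundary_degen n (x : n.+1.-tuple X) :
  degenerate x -> gen_boundary x \in @degen_chain n.
Proof.
move=> /existsP[k /existsP[l /andP[/eqP lk /eqP xkl]]].
have kl : l != k by apply/eqP => /(congr1 val) /=; lia.
pose F (i : 'I_n.+1) : rack_chain n :=
  (-1) ^+ i.+1 *: (<< face0 i x >> - << face1 i x >>).
have -> : gen_boundary x = \sum_i F i.
  rewrite [RHS](bigID (fun i : 'I_n.+1 => (0 < i)%N)) /=.
  rewrite [X in _ = _ + X]big1 ?addr0 // => i; rewrite -eqn0Ngt => /eqP i0.
  have -> : i = ord0 by apply: val_inj.
  by rewrite /F face01_ord0 subrr scaler0.
rewrite (bigD1 k) //= (bigD1 l) //= addrA.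
have -> : F k + F l = 0.
  have [e0 e1] := face_adjacent lk xkl.
  by rewrite /F e0 e1 lk -scalerDl (exprS _ k.+1) mulN1r subrr scale0r.
rewrite add0r; apply: rpred_sum => i /andP[ik il].
have [D0 D1] := degenerate_face lk xkl ik il.
by rewrite degen_chainZ // rpredB ?degen_chain1.
Qed.

Lemma rack_boundary_degen n (c : rack_chain n.+1) :
  c \in @degen_chain n.+1 -> rack_boundary c \in @degen_chain n.
Proof.
move=> /asboolP[s /allP sD ->]; rewrite raddf_sum big_seq.
apply: rpred_sum => u /sD uD; rewrite /= rack_boundaryZ rack_boundaryU.
by rewrite degen_chainZ ?gen_boundary_degen.
Qed.

(* C_n^Q(X) *)
Definition quandle_chain n : zmodType := Quotient.quot (@degen_chain n).

Definition quandle_boundary n (c : quandle_chain n.+1) : quandle_chain n :=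
  \pi_(Quotient.quot (@degen_chain n)) (rack_boundary (repr c)).

Lemma quandle_boundaryE n (c : rack_chain n.+1) :
  quandle_boundary (\pi_(Quotient.quot (@degen_chain n.+1)) c) =
  \pi_(Quotient.quot (@degen_chain n)) (rack_boundary c).
Proof.
apply/eqP; rewrite -Quotient.idealrBE -raddfB rack_boundary_degen //.
by rewrite Quotient.idealrBE reprK.
Qed.

Lemma quandle_boundaryB n : zmod_morphism (@quandle_boundary n).
Proof.
move=> c d.
have -> : c - d = \pi_(Quotient.quot (@degen_chain n.+1)) (repr c - repr d).
  by rewrite raddfB /= !reprK.
by rewrite quandle_boundaryE !raddfB.
Qed.

HB.instance Definition _ n := GRing.isZmodMorphism.Build
  (quandle_chain n.+1) (quandle_chain n) (@quandle_boundary n)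
  (@quandle_boundaryB n).

End Chains.

Section Cohomology.
Variables (X : quandleType) (A : zmodType).

Definition is_cochain n : {pred quandle_chain X n -> A} :=
  fun f => `[< zmod_morphism f >].

Lemma is_cochain_zmod n : zmod_closed (@is_cochain n).
Proof.
split=> [|f g /asboolP fB /asboolP gB]; apply/asboolP => c d.
  by rewrite subr0.
by rewrite !fctE /= fB gB opprD addrACA -opprD.
Qed.

HB.instance Definition _ n := GRing.isZmodClosed.Build
  (quandle_chain X n -> A) (@is_cochain n) (@is_cochain_zmod n).

(* C_Q^n(X; A) = Hom(C_n^Q(X), A), under pointwise addition *)
Record cochain n := Cochain {
  cochain_val : quandle_chain X n -> A;
  _ : cochain_val \in @is_cochain n
}.

HB.instance Definition _ n := [isSub for @cochain_val n].
HB.instance Definition _ n := [Choice of cochain n by <:].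
HB.instance Definition _ n := [SubChoice_isSubZmodule of cochain n by <:].

Lemma coboundary_subproof n (f : cochain n) :
  cochain_val f \o @quandle_boundary X n \in @is_cochain n.+1.
Proof.
case: f => f /= /asboolP fB; apply/asboolP => c d.
by rewrite /= raddfB fB.
Qed.

Definition coboundary n (f : cochain n) : cochain n.+1 :=
  Cochain (coboundary_subproof f).

Lemma coboundaryB n : zmod_morphism (@coboundary n).
Proof. by move=> f g; apply: val_inj. Qed.

HB.instance Definition _ n := GRing.isZmodMorphism.Build
  (cochain n) (cochain n.+1) (@coboundary n) (@coboundaryB n).

Definition is_cocycle n : {pred cochain n} := fun f => coboundary f == 0.

Lemma is_cocycle_zmod n : zmod_closed (@is_cocycle n).
Proof.
split=> [|f g /eqP f0 /eqP g0]; apply/eqP; first exact: raddf0.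
by rewrite raddfB /= f0 g0 subr0.
Qed.

HB.instance Definition _ n := GRing.isZmodClosed.Build
  (cochain n) (@is_cocycle n) (@is_cocycle_zmod n).

Record cocycle n := Cocycle {
  cocycle_val : cochain n;
  _ : cocycle_val \in @is_cocycle n
}.

HB.instance Definition _ n := [isSub for @cocycle_val n].
HB.instance Definition _ n := [Choice of cocycle n by <:].
HB.instance Definition _ n := [SubChoice_isSubZmodule of cocycle n by <:].

(* C_Q^{-1}(X; A) = 0, so the only coboundary in degree 0 is zero. *)
Definition is_coboundary n : cocycle n -> Prop :=
  match n with
  | 0 => fun z => z = 0
  | n'.+1 => fun z => exists f : cochain n', cocycle_val z = coboundary f
  end.

Definition coboundaries n : {pred cocycle n} := fun z => `[< is_coboundary z >].

Lemma coboundaries_zmod n : zmod_closed (@coboundaries n).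
Proof.
case: n => [|n]; split=> [|z w /asboolP /= zB /asboolP /= wB];
  apply/asboolP => /=.
- by [].
- by rewrite zB wB subrr.
- by exists 0; rewrite raddf0.
- have [f fz] := zB; have [g gw] := wB.
  by exists (f - g); rewrite !raddfB /= -fz -gw.
Qed.

HB.instance Definition _ n := GRing.isZmodClosed.Build
  (cocycle n) (@coboundaries n) (@coboundaries_zmod n).

Definition quandle_cohomology n : zmodType := Quotient.quot (@coboundaries n).

End Cohomology.

Definition nontrivial (V : zmodType) := exists v : V, v != 0.

(* H^m_Q(X; X) for the Alexander quandle X on M, with coefficients in the     *)
(* additive group of M.                                                       *)
Definition alexander_cohomology (R : idomainType) (M : lmodType (laurent R))
    (m : nat) : zmodType :=
  quandle_cohomology (alexander M) M m.

Definition xi (R : idomainType) (k : nat) : laurent R :=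
  \sum_(0 <= i < k) (- laurent_t) ^+ i.

Definition quadratic_relator (p : nat) (n : int) : laurent 'F_p :=
  laurent_t - (1 - laurent_t) ^+ 2 *~ n.

(* When p divides n, the relator is the unit t, so that the quotient of       *)
(* Z_p[t, t^-1] by it is zero.                                                *)
Lemma quadratic_relator_dvd (p m : nat) (n : int) : prime p -> (p %| n)%Z ->
  ~ nontrivial (alexander_cohomology (laurent_quot (quadratic_relator p n)) m).
Proof.
move=> p_pr /dvdzP[k ->].
have -> : quadratic_relator p (k * p) = laurent_t.
  rewrite /quadratic_relator mulrC mulrzA.
  suff -> : (1 - laurent_t : laurent 'F_p) ^+ 2 *~ p = 0.
    by rewrite mul0rz subr0.
  rewrite -pmulrn -mulr_natr; suff -> : p%:R = 0 :> laurent 'F_p by rewrite mulr0.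
  apply: val_inj; rewrite rmorph_nat rmorph0 -(rmorph_nat (@tofrac _)).
  by rewrite -(rmorph_nat polyC) pchar_Fp_0 // !rmorph0.
have M0 (x : laurent_quot (laurent_t : laurent 'F_p)) : x = 0.
  have [f ->] := laurent_pi_surj x.
  rewrite -(raddf0 (\pi_(Quotient.quot (pideal laurent_t)))).
  apply: laurent_pi_eq; rewrite subr0; apply/asboolP; exists (f * laurent_tV).
  by rewrite -mulrA [laurent_tV * _]mulrC laurent_t_mulV mulr1.
case=> v /eqP; apply; rewrite -[v]reprK.
have -> : repr v = 0; last by rewrite raddf0.
do 2!apply: val_inj; apply/funext => c.
exact: etrans (M0 _) (esym (M0 _)).
Qed.

(* Main.v *)
Require Import Defs.
From HB Require Import structures.
From mathcomp Require Import all_boot all_order all_algebra.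
From mathcomp Require Import generic_quotient ring_quotient fraction.
From mathcomp Require Import boolp.
From mathcomp.multinomials Require Import freeg.
From mathcomp Require Import ring zify.

(** All the groups are shown to be non-trivial in the same way: a cocycle with
values in X takes a non-zero value on an explicit cycle, whereas coboundaries
vanish on cycles (nontrivial_cohomology).

The cocycles. Let B be a biadditive map on an Alexander quandle such that
B (t x) (t y) = B x y. In the coordinates x - y, y - z, ..., deleting a vertex
adds two consecutive coordinates, and acting by a vertex multiplies the
earlier ones by t; the coboundaries of B (x - y) y and of B (x - y) (y - z)
therefore telescope to 0 (pairing2_cocycle, pairing3_cocycle). Both functions
vanish on degenerate tuples.

The pairing. Every modulus h below is reciprocal: the involution
bar : t |-> t^-1 of R[t, t^-1] maps h to a multiple of itself, so it acts on
R[t, t^-1] / (h), and B x y = bar x * y is invariant because bar t * t = 1.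
Over Z_p, when t^(q+1) = 1 in the quotient for a power q of p, bar is
the Frobenius map x |-> x^q there, and the cocycles are the polynomials
(x - y)^q y and (x - y)^q (y - z).

The cycles. They come from colourings of knot diagrams, with the regions
coloured too in degree 3. For h = xi_k, the closure of the k-th power of the
standard generator of the braid group on two strands is coloured by the
elements a_i = xi_i, with a_i * a_(i+1) = a_(i+2) and a period k. Summing the
values of the cocycle gives v with (1 + t) v equal to k up to a unit, modulo
h, and k is invertible for k = 2^n + 1 and for k = (p^n + 1) / 2, since
2k = p^n + 1 (nontrivial_xi). For h = t - N (1 - t)^2, the genus one knot with two
antiparallel twist regions, of N full twists and of one, has a colouring by
X; the value of the cocycle is - N (1 + t), and a polynomial of degree 1
is not divisible by h, which has degree 2 (twist_cycle3P,
twist_cycle3_value, nontrivial_twist). *)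

Set Implicit Arguments.
Unset Strict Implicit.
Unset Printing Implicit Defensive.

Import GRing.Theory.
Local Open Scope ring_scope.
Local Open Scope quotient_scope.

(** * Detecting cohomology classes on cycles *)

Section Criterion.
Variables (X : quandleType) (A : zmodType) (n : nat).
Implicit Types (phi : n.-tuple X -> A).

(** The codomain of [fglift] must be a module over the integers; [zmodule A] is
A with that structure. *)
Definition rack_eval phi : rack_chain X n -> A :=
  fglift (phi : n.-tuple X -> zmodule A).

HB.instance Definition _ phi := GRing.isZmodMorphism.Build
  (rack_chain X n) A (@rack_eval phi)
  (lift_is_additive (phi : n.-tuple X -> zmodule A)).

Lemma rack_evalU phi x : rack_eval phi << x >> = phi x.
Proof. by rewrite /rack_eval liftU scale1r. Qed.

Lemma rack_evalZ phi k c : rack_eval phi (k *: c) = rack_eval phi c *~ k.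
Proof. by rewrite -[k]intz scaler_int raddfMz intz. Qed.

Lemma rack_eval_degen phi c : (forall x, degenerate x -> phi x = 0) ->
  c \in @degen_chain X n -> rack_eval phi c = 0.
Proof.
move=> phiD /asboolP[s /allP sD ->].
rewrite raddf_sum big_seq big1 // => u /sD uD.
by rewrite /= rack_evalZ rack_evalU phiD ?mul0rz.
Qed.

Lemma quandle_eval_subproof phi : (forall x, degenerate x -> phi x = 0) ->
  (fun c : quandle_chain X n => rack_eval phi (repr c)) \in @is_cochain X A n.
Proof.
move=> phiD; apply/asboolP => c d; apply/eqP; rewrite -subr_eq0 -!raddfB.
apply/eqP/rack_eval_degen => //.
by rewrite Quotient.idealrBE reprK !raddfB /= !reprK.
Qed.

Definition quandle_eval phi phiD : cochain X A n :=
  Cochain (@quandle_eval_subproof phi phiD).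

Lemma quandle_evalE phi phiD c :
  cochain_val (@quandle_eval phi phiD) (\pi_(quandle_chain X n) c) =
  rack_eval phi c.
Proof.
apply/eqP; rewrite -subr_eq0 -raddfB /= (rack_eval_degen phiD) //.
by rewrite Quotient.idealrBE reprK.
Qed.

End Criterion.

Lemma rack_chain_ind (X : quandleType) n (P : rack_chain X n -> Prop) :
  P 0 -> (forall c k x, P c -> P (k *: << x >> + c)) -> forall c, P c.
Proof.
move=> P0 PD c; rewrite -[c]freeg_sumE; elim: (dom c) => [|x s IH].
  by rewrite big_nil.
rewrite big_cons.
suff -> : << coeff x c *g x >> = coeff x c *: << x >> :> rack_chain X n.
  exact: PD.
by apply/eqP/freeg_eqP => y; rewrite coeffZ !coeffU mul1r.
Qed.

(** The pairing of cochains with chains is well defined on cohomology: a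
coboundary takes the value 0 on every cycle. *)
Lemma nontrivial_cohomology (X : quandleType) (A : zmodType) n
    (phi : n.+1.-tuple X -> A) (c : rack_chain X n.+1) :
    (forall x, degenerate x -> phi x = 0) ->
    (forall y, rack_eval phi (gen_boundary y) = 0) ->
    rack_boundary c = 0 -> rack_eval phi c <> 0 ->
  nontrivial (quandle_cohomology X A n.+1).
Proof.
move=> phiD phi_coc c_cyc phi_c.
have phiZ : quandle_eval phiD \in @is_cocycle X A n.+1.
  apply/eqP/val_inj/funext => d; rewrite /= -[d]reprK quandle_boundaryE.
  rewrite [LHS](quandle_evalE phiD).
  elim/rack_chain_ind: (repr d) => [|b k y IH]; first by rewrite !raddf0.
  rewrite !raddfD /= IH rack_boundaryZ rack_boundaryU rack_evalZ phi_coc.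
  by rewrite mul0rz add0r.
exists (\pi_(quandle_cohomology X A n.+1) (Cocycle phiZ)); apply/eqP => phi0.
apply: phi_c.
have : (Cocycle phiZ : cocycle X A n.+1) \in @coboundaries X A n.+1.
  by rewrite -[Cocycle _]subr0 Quotient.idealrBE phi0 raddf0.
move=> /asboolP[g].
move=> /(congr1 (fun f => cochain_val f (\pi_(quandle_chain X n.+1) c))).
rewrite [LHS](quandle_evalE phiD) => ->; rewrite /= quandle_boundaryE c_cyc.
case: g => g /= /asboolP gB.
by rewrite raddf0; have := gB 0 0; rewrite !subr0 subrr.
Qed.

(** * Boundaries in low degrees *)

Section LowDegree.
Variable X : quandleType.
Implicit Types x y z w : X.

Lemma gen_boundary2 x y :
  gen_boundary [tuple x; y] = << [tuple x] >> - << [tuple qop x y] >>.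
Proof.
rewrite /gen_boundary big_mkcond !big_ord_recl big_ord0 /= add0r addr0.
rewrite expr2 mulrNN mulr1 scale1r.
by congr (<< _ >> - << _ >>); apply: eq_from_tnth => -[[|?] ?] //;
  rewrite tnth_mktuple !(tnth_nth x).
Qed.

Lemma gen_boundary3 x y z :
  gen_boundary [tuple x; y; z] =
  (<< [tuple x; z] >> - << [tuple qop x y; z] >>)
  - (<< [tuple x; y] >> - << [tuple qop x z; qop y z] >>).
Proof.
rewrite /gen_boundary big_mkcond !big_ord_recl big_ord0 /= add0r addr0.
rewrite !exprS expr0 !mulr1 mulrNN mulr1 scale1r scaleN1r.
by congr ((<< _ >> - << _ >>) - (<< _ >> - << _ >>));
  apply: eq_from_tnth => -[[|[|?]] ?] //; rewrite tnth_mktuple !(tnth_nth x).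
Qed.

Lemma gen_boundary4 x y z w :
  gen_boundary [tuple x; y; z; w] =
  (<< [tuple x; z; w] >> - << [tuple qop x y; z; w] >>)
  - (<< [tuple x; y; w] >> - << [tuple qop x z; qop y z; w] >>)
  + (<< [tuple x; y; z] >> - << [tuple qop x w; qop y w; qop z w] >>).
Proof.
rewrite /gen_boundary big_mkcond !big_ord_recl big_ord0 /= add0r addr0 addrA.
rewrite !exprS expr0 !mulr1 !mulrNN !mulr1 scale1r scaleN1r !scale1r.
by congr ((<< _ >> - << _ >>) - (<< _ >> - << _ >>) + (<< _ >> - << _ >>));
  apply: eq_from_tnth => -[[|[|[|?]]] ?] //; rewrite tnth_mktuple !(tnth_nth x).
Qed.

Lemma tuple2P (y : 2.-tuple X) : exists a b, y = [tuple a; b].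
Proof. case: y => -[|a [|b [|? ?]]] // ?; exists a, b; exact: val_inj. Qed.

Lemma tuple3P (y : 3.-tuple X) : exists a b c, y = [tuple a; b; c].
Proof.
case: y => -[|a [|b [|c [|? ?]]]] // ?; exists a, b, c; exact: val_inj.
Qed.

Lemma tuple4P (y : 4.-tuple X) : exists a b c d, y = [tuple a; b; c; d].
Proof.
case: y => -[|a [|b [|c [|d [|? ?]]]]] // ?; exists a, b, c, d; exact: val_inj.
Qed.

End LowDegree.

(** * Cocycles from invariant pairings *)

Section Pairing.
Variables (R : idomainType) (M : lmodType (laurent R)) (A : zmodType).
Variable B : M -> M -> A.
Hypothesis BDl : forall x y z, B (x + y) z = B x z + B y z.
Hypothesis BDr : forall x y z, B x (y + z) = B x y + B x z.
Hypothesis B_t : forall x y, B (laurent_t *: x) (laurent_t *: y) = B x y.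

Definition pairing2 (v : 2.-tuple (alexander M)) : A :=
  let x := tnth v 0 : M in let y := tnth v 1 : M in B (x - y) y.

Definition pairing3 (v : 3.-tuple (alexander M)) : A :=
  let x := tnth v 0 : M in let y := tnth v 1 : M in
  let z := tnth v 2%:R : M in
  B (x - y) (y - z).

Lemma pairing0l x : B 0 x = 0.
Proof. by apply: (addrI (B 0 x)); rewrite -BDl !addr0. Qed.

Lemma pairing0r x : B x 0 = 0.
Proof. by apply: (addrI (B x 0)); rewrite -BDr !addr0. Qed.

Lemma pairing2_degenerate v : degenerate v -> pairing2 v = 0.
Proof.
have [x [y ->]] := tuple2P v; rewrite /pairing2 !(tnth_nth x).
case/existsP=> -[[|[|i]] i2] // /existsP[[[|[|j]] j2]] //=.
by rewrite !(tnth_nth x) => /eqP /= ->; rewrite subrr pairing0l.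
Qed.

Lemma pairing3_degenerate v : degenerate v -> pairing3 v = 0.
Proof.
have [x [y [z ->]]] := tuple3P v; rewrite /pairing3 !(tnth_nth x).
case/existsP=> -[[|[|[|i]]] i3] // /existsP[[[|[|[|j]]] j3]] //=;
  rewrite !(tnth_nth x) => /eqP /= ->; rewrite subrr.
- exact: pairing0l.
- exact: pairing0r.
Qed.

(** The quandle operation by z is affine with linear part t; hence it
multiplies differences by t. *)
Lemma alexander_subr (x y z : M) :
  (laurent_t *: x + (1 - laurent_t) *: z)
  - (laurent_t *: y + (1 - laurent_t) *: z) = laurent_t *: (x - y).
Proof. by rewrite opprD addrACA subrr addr0 -scalerBr. Qed.

Lemma alexander_subl (x y z : M) :
  (laurent_t *: x + (1 - laurent_t) *: y) - z = laurent_t *: (x - y) + (y - z).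
Proof. by rewrite scalerBl scale1r scalerBr addrCA addrAC addrC. Qed.

(** With u = x - y and v = y - z, every term is bilinear in u, v and y or z;
invariance turns B (t u) (t z) into B u z, and the sum cancels. *)
Lemma pairing2_boundary (x y z : M) :
  (B (x - z) z - B (laurent_t *: x + (1 - laurent_t) *: y - z) z)
  - (B (x - y) y - B (laurent_t *: x + (1 - laurent_t) *: z
                      - (laurent_t *: y + (1 - laurent_t) *: z))
                     (laurent_t *: y + (1 - laurent_t) *: z)) = 0.
Proof.
rewrite alexander_subr alexander_subl -[x - z](subrKA y).
move: (x - y) (y - z) => u v.
rewrite scalerBl scale1r !BDl !BDr B_t.
have -> : B (laurent_t *: u) (- (laurent_t *: z)) = - B u z.
  by apply/eqP; rewrite -addr_eq0 -[B u z]B_t -BDr addNr pairing0r.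
rewrite [in X in X - _]opprD [in X in X - _]addrACA subrr addr0.
rewrite [in X in _ - X]opprD [in X in _ - X]addrA subrr sub0r opprK.
by rewrite addrA subrK subrr.
Qed.

(** With u = x - y, v = y - z and s = z - w, the six terms are values of B at
sums of u, t u, v, t v and s, and cancel by B (t u) (t v) = B u v. *)
Lemma pairing3_boundary (x y z w : M) :
  (B (x - z) (z - w) - B (laurent_t *: x + (1 - laurent_t) *: y - z) (z - w))
  - (B (x - y) (y - w) - B (laurent_t *: x + (1 - laurent_t) *: z
                      - (laurent_t *: y + (1 - laurent_t) *: z))
                     (laurent_t *: y + (1 - laurent_t) *: z - w))
  + (B (x - y) (y - z) - B (laurent_t *: x + (1 - laurent_t) *: w
                      - (laurent_t *: y + (1 - laurent_t) *: w))
                      (laurent_t *: y + (1 - laurent_t) *: w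
                      - (laurent_t *: z + (1 - laurent_t) *: w))) = 0.
Proof.
rewrite !alexander_subr !alexander_subl !B_t subrr addr0.
rewrite -[x - z](subrKA y) -[y - w](subrKA z).
move: (x - y) (y - z) (z - w) => u v s; rewrite !BDl !BDr B_t.
rewrite [in X in X - _]opprD [in X in X - _]addrACA subrr addr0.
by rewrite [in X in _ - X]opprD [in X in _ - X]addrACA subrr add0r subrr.
Qed.

Lemma pairing2_cocycle v : rack_eval pairing2 (gen_boundary v) = 0.
Proof.
have [x [y [z ->]]] := tuple3P v; rewrite gen_boundary3.
rewrite !(raddfB (rack_eval _)) /= !rack_evalU /pairing2 !(tnth_nth x).
exact: (pairing2_boundary x y z).
Qed.

Lemma pairing3_cocycle v : rack_eval pairing3 (gen_boundary v) = 0.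
Proof.
have [x [y [z [w ->]]]] := tuple4P v.
rewrite gen_boundary4 !(raddfD (rack_eval _), raddfN (rack_eval _)) /=.
rewrite !rack_evalU /pairing3 !(tnth_nth x).
exact: (pairing3_boundary x y z w).
Qed.

End Pairing.

(** * The involution of the Laurent polynomial ring *)

Section LaurentSubst.
Variable R : idomainType.
Local Notation L := (laurent R).
Local Notation t := (laurent_t : L).
Local Notation tV := (laurent_tV : L).

Lemma laurent_poly_subproof (p : {poly R}) : tofrac p \in @is_laurent R.
Proof. by apply/asboolP; exists p, 0%N; rewrite expr0 divr1. Qed.

Definition laurent_poly (p : {poly R}) : L := Laurent (laurent_poly_subproof p).

Lemma laurent_poly_zmod : zmod_morphism laurent_poly.
Proof. by move=> p q; apply: val_inj; rewrite /= rmorphB. Qed.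

Lemma laurent_poly_monoid : monoid_morphism laurent_poly.
Proof.
by split=> [|p q]; apply: val_inj; rewrite /= ?rmorph1 ?rmorphM.
Qed.

HB.instance Definition _ :=
  GRing.isZmodMorphism.Build {poly R} L laurent_poly laurent_poly_zmod.
HB.instance Definition _ :=
  GRing.isMonoidMorphism.Build {poly R} L laurent_poly laurent_poly_monoid.

Lemma laurent_polyX : laurent_poly 'X = t.
Proof. exact: val_inj. Qed.

Lemma laurent_poly_inj : injective laurent_poly.
Proof. by move=> p q /(congr1 val) /= /eqP; rewrite tofrac_eq => /eqP. Qed.

Lemma laurentP (f : L) : exists pk : {poly R} * nat,
  f * t ^+ pk.2 = laurent_poly pk.1.
Proof.
case: f => f fL; have /asboolP[p [k fE]] := fL; exists (p, k).
apply: val_inj; rewrite rmorphM rmorphXn /= fE divfK //.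
by rewrite expf_neq0 // tofrac_eq0 polyX_eq0.
Qed.

Lemma laurent_tXV k : t ^+ k * tV ^+ k = 1.
Proof. by rewrite -exprMn laurent_t_mulV expr1n. Qed.

Definition inv_eval (p : {poly R}) : L :=
  (map_poly (laurent_poly \o polyC) p).[tV].

Lemma inv_eval_zmod : zmod_morphism inv_eval.
Proof. by move=> p q; rewrite /inv_eval rmorphB hornerD hornerN. Qed.

Lemma inv_eval_monoid : monoid_morphism inv_eval.
Proof.
by split=> [|p q]; rewrite /inv_eval ?rmorph1 ?hornerC // rmorphM hornerM.
Qed.

HB.instance Definition _ :=
  GRing.isZmodMorphism.Build {poly R} L inv_eval inv_eval_zmod.
HB.instance Definition _ :=
  GRing.isMonoidMorphism.Build {poly R} L inv_eval inv_eval_monoid.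

Lemma inv_evalX : inv_eval 'X = tV.
Proof. by rewrite /inv_eval map_polyX hornerX. Qed.

(** The substitution of t^-1 for t in f = p / t^k. The pair (p, k) is any one
representing f; [laurent_barE] shows that the choice does not matter. *)
Definition laurent_bar (f : L) : L :=
  let pk := projT1 (cid (laurentP f)) in inv_eval pk.1 * t ^+ pk.2.

Lemma laurent_barE f p k :
  f * t ^+ k = laurent_poly p -> laurent_bar f = inv_eval p * t ^+ k.
Proof.
rewrite /laurent_bar; case: cid => -[q l] /= fq fp.
have /laurent_poly_inj/(congr1 inv_eval) :
    laurent_poly (q * 'X^k) = laurent_poly (p * 'X^l).
  by rewrite !rmorphM !rmorphXn /= !laurent_polyX -fq -fp mulrAC.
rewrite !rmorphM !rmorphXn /= !inv_evalX.
move=> qp; transitivity (inv_eval q * tV ^+ k * (t ^+ k * t ^+ l)).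
  by rewrite mulrA -[_ * _ * t ^+ k]mulrA [tV ^+ k * _]mulrC laurent_tXV mulr1.
rewrite qp mulrCA -[_ * _ * t ^+ l]mulrA [tV ^+ l * _]mulrC laurent_tXV mulr1.
exact: mulrC.
Qed.

Lemma laurent_bar_poly p : laurent_bar (laurent_poly p) = inv_eval p.
Proof. by rewrite (@laurent_barE _ p 0) mulr1. Qed.

Lemma laurent_bar_zmod : zmod_morphism laurent_bar.
Proof.
move=> f g; have [[p k] /= fp] := laurentP f; have [[q l] /= gq] := laurentP g.
rewrite (laurent_barE fp) (laurent_barE gq).
rewrite (@laurent_barE _ (p * 'X^l - q * 'X^k) (k + l)).
  rewrite !(rmorphB, rmorphM, rmorphXn) /= inv_evalX mulrBl exprD.
  congr (_ - _).
    by rewrite [t ^+ k * _]mulrC mulrA -[_ * _ * t ^+ l]mulrA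
      [tV ^+ l * _]mulrC laurent_tXV mulr1.
  by rewrite mulrA -[_ * _ * t ^+ k]mulrA [tV ^+ k * _]mulrC laurent_tXV mulr1.
rewrite !(rmorphB, rmorphM, rmorphXn) /= !laurent_polyX -fp -gq exprD mulrBl.
by congr (_ - _); rewrite -mulrA // [t ^+ l * _]mulrC.
Qed.

Lemma laurent_bar_monoid : monoid_morphism laurent_bar.
Proof.
split=> [|f g].
  by rewrite -[in LHS](rmorph1 laurent_poly) laurent_bar_poly rmorph1.
have [[p k] /= fp] := laurentP f; have [[q l] /= gq] := laurentP g.
rewrite (laurent_barE fp) (laurent_barE gq) (@laurent_barE _ (p * q) (k + l)).
  by rewrite rmorphM exprD mulrACA.
by rewrite rmorphM exprD mulrACA fp gq.
Qed.

HB.instance Definition _ :=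
  GRing.isZmodMorphism.Build L L laurent_bar laurent_bar_zmod.
HB.instance Definition _ :=
  GRing.isMonoidMorphism.Build L L laurent_bar laurent_bar_monoid.

Lemma laurent_bar_t : laurent_bar t = tV.
Proof. by rewrite -laurent_polyX laurent_bar_poly inv_evalX. Qed.

Lemma laurent_bar_tV : laurent_bar tV = t.
Proof.
rewrite (@laurent_barE _ 1 1) ?rmorph1 ?mul1r //.
by rewrite expr1 mulrC laurent_t_mulV.
Qed.

End LaurentSubst.

(** Clearing denominators gives p X^k = q h; as h is prime to X, it divides
p. *)
Lemma pideal_dvdp (K : fieldType) (h p : {poly K}) :
  h`_0 != 0 -> laurent_poly p \in pideal (laurent_poly h) -> h %| p.
Proof.
move=> h0 /asboolP[g ph]; have [[q k] /= gq] := laurentP g.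
have /laurent_poly_inj E : laurent_poly (p * 'X^k) = laurent_poly (q * h).
  by rewrite !rmorphM rmorphXn /= laurent_polyX ph -gq mulrAC.
rewrite -(@Gauss_dvdpl _ _ 'X^k) ?E ?dvdp_mull //.
have := coprimep_XsubC h 0; rewrite polyC0 subr0 => hX.
by rewrite coprimep_expr // hX /root horner_coef0.
Qed.

(** * The polynomials xi *)

Section Xi.
Variable R : idomainType.
Local Notation L := (laurent R).
Local Notation t := (laurent_t : L).
Local Notation tV := (laurent_tV : L).

Lemma xi0 : xi R 0 = 0.
Proof. by rewrite /xi big_geq. Qed.

Lemma xiS k : xi R k.+1 = xi R k + (- t) ^+ k.
Proof. by rewrite /xi big_nat_recr. Qed.

Lemma xi1 : xi R 1 = 1.
Proof. by rewrite xiS xi0 add0r. Qed.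

Lemma xi_geom k : (1 + t) * xi R k = 1 - (- t) ^+ k.
Proof.
elim: k => [|k IH]; first by rewrite xi0 mulr0 subrr.
by rewrite xiS mulrDr IH exprS; ring.
Qed.

Lemma xiSl k : xi R k.+1 = 1 - t * xi R k.
Proof.
by rewrite xiS -[X in _ + X](subKr 1) -xi_geom; ring.
Qed.

(** xi_k is reciprocal up to a unit: reversing the order of the terms of
bar xi_k * (-t)^k gives (-t) + ... + (-t)^k. *)
Lemma laurent_bar_xi k : laurent_bar (xi R k) * (- t) ^+ k = - t * xi R k.
Proof.
elim: k => [|k IH]; first by rewrite xi0 rmorph0 mul0r mulr0.
have rs : (- tV) ^+ k * (- t) ^+ k = 1.
  by rewrite -exprMn mulrNN mulrC laurent_t_mulV expr1n.
rewrite {1}xiS xiSl rmorphD rmorphXn rmorphN /= laurent_bar_t exprS mulrCA.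
by rewrite mulrDl IH rs; ring.
Qed.

Lemma bar_xiE k :
  laurent_bar (xi R k) = - t * (- tV) ^+ k * xi R k.
Proof.
have ss : (- t) ^+ k * (- tV) ^+ k = 1.
  by rewrite -exprMn mulrNN laurent_t_mulV expr1n.
by rewrite -[LHS]mulr1 -ss mulrA laurent_bar_xi mulrAC.
Qed.

Lemma bar_xi_mul k :
  (- tV) ^+ k * xi R k.+1 = laurent_bar (xi R k.+1).
Proof. by rewrite bar_xiE exprS; ring: (laurent_t_mulV R). Qed.

End Xi.

(** * Cycles from coloured knot diagrams *)

Section Cycles.
Variables (R : idomainType) (M : lmodType (laurent R)) (u : M).
Local Notation t := (laurent_t : laurent R).
Local Notation tV := (laurent_tV : laurent R).

Definition line_pt (a : laurent R) : alexander M := a *: u.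

Lemma qop_line_pt a b :
  qop (line_pt a) (line_pt b) = line_pt (t * a + (1 - t) * b).
Proof. by rewrite /line_pt scalerDl -!scalerA. Qed.

Lemma line_ptP a b : (a - b) *: u = 0 -> line_pt a = line_pt b.
Proof. by rewrite scalerBl => /eqP; rewrite subr_eq0 => /eqP. Qed.

(** A positive crossing with under-arc x and over-arc y contributes (x, y), and
(r, x, y) when r colours the region next to both arcs from which the
quandle acts. Here the k crossings of two parallel strands have arcs xi_i and
xi_(i+1), and the outer region, which meets every crossing, has colour 0. *)
Definition torus_cycle2 k : rack_chain (alexander M) 2 :=
  \sum_(0 <= i < k) << [tuple line_pt (xi R i); line_pt (xi R i.+1)] >>.

Definition torus_cycle3 k : rack_chain (alexander M) 3 :=
  \sum_(0 <= i < k)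
    << [tuple line_pt 0; line_pt (xi R i); line_pt (xi R i.+1)] >>.

Lemma qop_xi i :
  qop (line_pt (xi R i)) (line_pt (xi R i.+1)) = line_pt (xi R i.+2).
Proof. by rewrite qop_line_pt; congr line_pt; rewrite !xiS exprS; ring. Qed.

Section Torus.
Variable k : nat.
Hypothesis xi_u : xi R k *: u = 0.

Lemma line_pt_xi_k : line_pt (xi R k) = line_pt (xi R 0).
Proof. by apply: line_ptP; rewrite xi0 subr0. Qed.

Lemma line_pt_xi_kS : line_pt (xi R k.+1) = line_pt (xi R 1).
Proof.
apply: line_ptP; have -> : xi R k.+1 - xi R 1 = (- t) * xi R k.
  by rewrite xiSl xi1; ring.
by rewrite -scalerA xi_u scaler0.
Qed.

(** The boundary of the i-th term is F (i + 1) - F i, and F k = F 0 because the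
colouring closes up after k crossings. *)
Lemma torus_cycle2P : rack_boundary (torus_cycle2 k) = 0.
Proof.
pose F i : rack_chain (alexander M) 1 :=
  - (<< [tuple line_pt (xi R i)] >> + << [tuple line_pt (xi R i.+1)] >>).
rewrite raddf_sum (eq_bigr (fun i => F i.+1 - F i)) => [|i _].
  by rewrite telescope_sumr // /F line_pt_xi_k line_pt_xi_kS subrr.
rewrite /= rack_boundaryU gen_boundary2 qop_xi /F opprK [RHS]addrC.
by rewrite addrKA.
Qed.

Lemma torus_cycle3P : rack_boundary (torus_cycle3 k) = 0.
Proof.
pose F i : rack_chain (alexander M) 2 :=
  << [tuple line_pt 0; line_pt (xi R i)] >>
  + << [tuple qop (line_pt 0) (line_pt (xi R i)); line_pt (xi R i.+1)] >>.
rewrite raddf_sum (eq_bigr (fun i => F i.+1 - F i)) => [|i _].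
  by rewrite telescope_sumr // /F line_pt_xi_k line_pt_xi_kS subrr.
rewrite /= rack_boundaryU gen_boundary3 qop_xi /F.
by rewrite opprB addrACA -opprD; congr (_ - _); exact: addrC.
Qed.

End Torus.

(** A full twist of two antiparallel strands with colours a and b translates
both by (t^-1 - 1) (a - b), so that a - b is preserved. From b_0 = 0 and
a_0 = 1, the first twist region then has the colours b_i = i e and
a_i = 1 + i e. The colour x_i of the bigon between the two crossings of the
i-th full twist is forced by those of the regions on both sides, e and 0,
which are x_i * a_(i+1) and x_i * b_i for every i. The last two
terms are the crossings of the second twist region: it has the opposite
direction, its strands are b_N and b_0, and its translation
(1 - t) (b_N - b_0) must carry them to a_N and a_0. That is the equation
N e (1 - t) = 1, i.e. t = N (1 - t)^2. *)
Local Notation e := (tV - 1).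

Definition twist_a i : alexander M := line_pt (1 + i%:R * e).
Definition twist_b i : alexander M := line_pt (i%:R * e).
Definition twist_x i : alexander M := line_pt (- (i%:R * e ^+ 2)).

Definition twist_cycle3 N : rack_chain (alexander M) 3 :=
  \sum_(0 <= i < N) (<< [tuple twist_x i; twist_a i.+1; twist_b i] >>
                    + << [tuple twist_x i; twist_b i; twist_a i.+1] >>)
  - << [tuple line_pt e; twist_b 0; twist_b N] >>
  - << [tuple line_pt 0; twist_a N; twist_a 0] >>.

Lemma qop_twist_ab i : qop (twist_a i.+1) (twist_b i) = twist_a i.
Proof.
by rewrite qop_line_pt; congr line_pt; ring: (laurent_t_mulV R).
Qed.

Lemma qop_twist_ba i : qop (twist_b i) (twist_a i.+1) = twist_b i.+1.
Proof.
by rewrite qop_line_pt; congr line_pt; ring: (laurent_t_mulV R).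
Qed.

Lemma qop_twist_xa i : qop (twist_x i) (twist_a i.+1) = line_pt e.
Proof.
by rewrite qop_line_pt; congr line_pt; ring: (laurent_t_mulV R).
Qed.

Lemma qop_twist_xb i : qop (twist_x i) (twist_b i) = line_pt 0.
Proof.
by rewrite qop_line_pt; congr line_pt; ring: (laurent_t_mulV R).
Qed.

Section Twist.
Variable N : nat.
Hypothesis twist_u : (1 - N%:R * e * (1 - t)) *: u = 0.

Lemma qop_twist_bb : qop (twist_b 0) (twist_b N) = twist_a 0.
Proof.
rewrite qop_line_pt; apply: line_ptP.
set d := (X in X *: u); suff -> : d = - (1 - N%:R * e * (1 - t)).
  by rewrite scaleNr twist_u oppr0.
by rewrite /d; ring.
Qed.

Lemma qop_twist_aa : qop (twist_a N) (twist_a 0) = twist_b N.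
Proof.
rewrite qop_line_pt; apply: line_ptP.
set d := (X in X *: u); suff -> : d = 1 - N%:R * e * (1 - t) by [].
by rewrite /d; ring.
Qed.

Lemma qop_twist_outer0 :
  qop (line_pt e) (twist_b 0) = qop (line_pt 0) (twist_a 0).
Proof.
by rewrite !qop_line_pt; congr line_pt; ring: (laurent_t_mulV R).
Qed.

Lemma qop_twist_outerN :
  qop (line_pt e) (twist_b N) = qop (line_pt 0) (twist_a N).
Proof.
by rewrite !qop_line_pt; congr line_pt; ring: (laurent_t_mulV R).
Qed.

(** The boundary of the first twist region telescopes to F N - F 0, which the
two crossings of the second region cancel. *)
Lemma twist_cycle3P : rack_boundary (twist_cycle3 N) = 0.
Proof.
pose F i : rack_chain (alexander M) 2 :=
  << [tuple line_pt e; twist_b i] >> - << [tuple line_pt 0; twist_a i] >>.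
rewrite !(raddfB (@rack_boundary _ 2)) raddf_sum.
rewrite (eq_bigr (fun i => F i.+1 - F i)) => [|i _].
  rewrite telescope_sumr // /= !rack_boundaryU !gen_boundary3.
  rewrite qop_twist_bb qop_twist_aa qop_twist_outer0 qop_twist_outerN /F.
  by apply/eqP/freeg_eqP => c; rewrite !(coeffB, coeffD, coeff0); ring.
rewrite raddfD /= !rack_boundaryU !gen_boundary3.
rewrite qop_twist_ab qop_twist_ba qop_twist_xa qop_twist_xb /F.
by apply/eqP/freeg_eqP => c; rewrite !(coeffB, coeffD); ring.
Qed.

End Twist.
End Cycles.

(** * The invariant pairing on a quotient by a reciprocal polynomial *)

Section BarPairing.
Variables (R : idomainType) (h : laurent R).
Hypothesis h_bar : laurent_bar h \in pideal h.
Local Notation M := (laurent_quot h).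
Local Notation u := (laurent_pi h 1 : M).
Local Notation t := (laurent_t : laurent R).
Local Notation tV := (laurent_tV : laurent R).

Lemma laurent_piE f : laurent_pi h f = f *: u.
Proof. by rewrite [RHS]laurent_scaleE mulr1. Qed.

Lemma laurent_pi_eq0 f : f *: u = 0 <-> f \in pideal h.
Proof.
rewrite -laurent_piE -[f in f \in _]subr0 Quotient.idealrBE raddf0.
by split=> [/eqP|/eqP].
Qed.

Definition bar_pairing (x y : M) : M :=
  laurent_bar (repr (x : Quotient.quot (pideal h))) *: y.

(** The representative chosen in [bar_pairing] does not matter, because bar
maps (h) to itself. *)
Lemma bar_pairingE f (y : M) : bar_pairing (f *: u) y = laurent_bar f *: y.
Proof.
apply/eqP; rewrite -subr_eq0 -scalerBl -rmorphB /=.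
have [g ->] := laurent_pi_surj y; rewrite (laurent_piE g) scalerA.
apply/eqP/laurent_pi_eq0; set d := repr _ - f.
suff /asboolP[a ->] : d \in pideal h.
  by rewrite mulrC rmorphM mulrA; exact: pidealM.
by rewrite Quotient.idealrBE reprK -laurent_piE.
Qed.

Lemma bar_pairingZ f g :
  bar_pairing (f *: u) (g *: u) = (laurent_bar f * g) *: u.
Proof. by rewrite bar_pairingE scalerA. Qed.

Lemma bar_pairingDl x y z :
  bar_pairing (x + y) z = bar_pairing x z + bar_pairing y z.
Proof.
have [f ->] := laurent_pi_surj x; have [g ->] := laurent_pi_surj y.
rewrite (laurent_piE f) (laurent_piE g) -scalerDl !bar_pairingE rmorphD.
exact: scalerDl.
Qed.

Lemma bar_pairingDr x y z :
  bar_pairing x (y + z) = bar_pairing x y + bar_pairing x z.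
Proof. exact: scalerDr. Qed.

Lemma bar_pairing_t x y : bar_pairing (t *: x) (t *: y) = bar_pairing x y.
Proof.
have [f ->] := laurent_pi_surj x; rewrite (laurent_piE f) scalerA !bar_pairingE.
rewrite scalerA rmorphM /= laurent_bar_t mulrAC [tV * t]mulrC laurent_t_mulV.
by rewrite mul1r.
Qed.

Lemma nontrivial_of_cycle2 c : rack_boundary c = 0 ->
  rack_eval (pairing2 bar_pairing) c <> 0 ->
  nontrivial (alexander_cohomology M 2).
Proof.
apply: nontrivial_cohomology.
  exact: (pairing2_degenerate bar_pairingDl).
exact: (pairing2_cocycle bar_pairingDl bar_pairingDr bar_pairing_t).
Qed.

Lemma nontrivial_of_cycle3 c : rack_boundary c = 0 ->
  rack_eval (pairing3 bar_pairing) c <> 0 ->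
  nontrivial (alexander_cohomology M 3).
Proof.
apply: nontrivial_cohomology.
  exact: (pairing3_degenerate bar_pairingDl bar_pairingDr).
exact: (pairing3_cocycle bar_pairingDl bar_pairingDr bar_pairing_t).
Qed.

Lemma pairing2_pt a b :
  pairing2 bar_pairing [tuple line_pt u a; line_pt u b] =
  (laurent_bar (a - b) * b) *: u.
Proof.
rewrite /pairing2 !(tnth_nth (line_pt u a)) /= /line_pt -scalerBl.
exact: bar_pairingZ.
Qed.

Lemma pairing3_pt a b c :
  pairing3 bar_pairing [tuple line_pt u a; line_pt u b; line_pt u c] =
  (laurent_bar (a - b) * (b - c)) *: u.
Proof.
rewrite /pairing3 !(tnth_nth (line_pt u a)) /= /line_pt -!scalerBl.
exact: bar_pairingZ.
Qed.

Lemma torus_cycle2_value k :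
  rack_eval (pairing2 bar_pairing) (torus_cycle2 u k) =
  - laurent_bar (\sum_(0 <= i < k) xi R i.+1) *: u.
Proof.
rewrite /torus_cycle2 !raddf_sum scaler_suml; apply: eq_bigr => i _ /=.
rewrite rack_evalU pairing2_pt; congr (_ *: _).
rewrite -bar_xi_mul xiS opprD addNKr.
by rewrite rmorphN rmorphXn rmorphN /= laurent_bar_t mulNr.
Qed.

Lemma torus_cycle3_value k :
  rack_eval (pairing3 bar_pairing) (torus_cycle3 u k) =
  (- t * \sum_(0 <= i < k) xi R i) *: u.
Proof.
rewrite /torus_cycle3 raddf_sum mulr_sumr scaler_suml; apply: eq_bigr => i _ /=.
rewrite rack_evalU pairing3_pt -laurent_bar_xi; congr (_ *: _).
by rewrite xiS sub0r rmorphN opprD addNKr mulrNN.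
Qed.

(** Each crossing pair of the first twist region contributes
- bar (b_i - a_(i+1)) (b_i - a_(i+1)) = - bar t^-1 * t^-1 = -1. *)
Lemma twist_cycle3_value N : (1 - N%:R * (tV - 1) * (1 - t)) *: u = 0 ->
  rack_eval (pairing3 bar_pairing) (twist_cycle3 u N) = (- N%:R * (1 + t)) *: u.
Proof.
move=> twist_u; rewrite /twist_cycle3 !(raddfB (rack_eval _)) raddf_sum /=.
rewrite (eq_bigr (fun _ => - 1 *: u)) => [|i _].
  rewrite sumr_const_nat subn0 !rack_evalU !pairing3_pt -scaler_nat.
  rewrite scalerA -!scalerBl !mul0r !addr0.
  rewrite !(rmorphB, rmorph0, rmorph1, rmorphD, rmorphM, rmorph_nat) /=.
  rewrite !laurent_bar_tV.
  (* The two scalars differ by N times the relation. *)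
  rewrite -[RHS]addr0 -[X in _ = _ + X](scaler0 _ N%:R) -twist_u scalerA.
  by rewrite -scalerDl; congr (_ *: _); ring: (laurent_t_mulV R).
rewrite (raddfD (rack_eval _)) /= !rack_evalU !pairing3_pt -scalerDl.
rewrite !(rmorphN, rmorphB, rmorph1, rmorphD, rmorphM, rmorphXn, rmorph_nat) /=.
by rewrite !laurent_bar_tV; congr (_ *: _); ring: (laurent_t_mulV R).
Qed.

Lemma pideal_bar f : f \in pideal h -> laurent_bar f \in pideal h.
Proof. by move=> /asboolP[g ->]; rewrite rmorphM; exact: pidealM. Qed.

(** Since (1 + t) xi_i = 1 - (-t)^i, multiplying the value of the cocycle by
1 + t, or by its image under bar, gives k modulo (h) up to a unit. *)
Lemma nontrivial_torus k m : xi R k \in pideal h -> k%:R \notin pideal h ->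
  m = 2%N \/ m = 3%N -> nontrivial (alexander_cohomology M m).
Proof.
move=> xi_h /negP k_h; have /laurent_pi_eq0 xi_u := xi_h.
case=> ->.
  apply: (nontrivial_of_cycle2 (torus_cycle2P xi_u)).
  rewrite torus_cycle2_value => /laurent_pi_eq0.
  set S := \sum_(0 <= i < k) _ => S_h.
  have SE : (1 + t) * S = k%:R + t * xi R k.
    rewrite /S mulr_sumr (eq_bigr (fun i => 1 + t * (- t) ^+ i)) => [|i _].
      by rewrite big_split /= sumr_const_nat subn0 -mulr_sumr.
    by rewrite xi_geom exprS; ring.
  apply: k_h; have -> : k%:R = - laurent_bar (1 + t) * (- laurent_bar S)
      - tV * laurent_bar (xi R k).
    rewrite mulrNN -rmorphM SE rmorphD rmorphM rmorph_nat /= laurent_bar_t.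
    by ring.
  by apply: rpredB; apply: pidealM; [exact: S_h | exact: pideal_bar].
apply: (nontrivial_of_cycle3 (torus_cycle3P xi_u)).
rewrite torus_cycle3_value => /laurent_pi_eq0.
set S := \sum_(0 <= i < k) _ => S_h.
have SE : (1 + t) * S = k%:R - xi R k.
  rewrite /S mulr_sumr (eq_bigr (fun i => 1 - (- t) ^+ i)) => [|i _].
    by rewrite big_split /= sumr_const_nat subn0 sumrN.
  by rewrite xi_geom.
apply: k_h; have -> : k%:R = - tV * (1 + t) * (- t * S) + xi R k.
  by rewrite -[X in _ = _ + X](subKr k%:R) -SE; ring: (laurent_t_mulV R).
by apply: rpredD; [exact: pidealM | exact: xi_h].
Qed.

End BarPairing.

(** * Non-vanishing of the values over a field *)

Section Field.
Variable K : fieldType.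
Local Notation t := (laurent_t : laurent K).
Local Notation tV := (laurent_tV : laurent K).

Lemma nat_notin_xi k :
  (1 < k)%N -> k%:R != 0 :> K -> k%:R \notin pideal (xi K k).
Proof.
move=> k1 kK; pose q : {poly K} := \poly_(i < k) (-1) ^+ i.
have -> : xi K k = laurent_poly q.
  rewrite /q poly_def rmorph_sum /xi big_mkord; apply: eq_bigr => i _ /=.
  rewrite -mul_polyC !(rmorphM, rmorphXn, rmorphN) /= laurent_polyX.
  by rewrite -exprMn rmorph1 mulN1r.
have q_size : size q = k.
  by rewrite size_poly_eq // expf_neq0 // oppr_eq0 oner_eq0.
rewrite -(rmorph_nat (@laurent_poly K)); apply/negP => /pideal_dvdp.
rewrite coef_poly ltnW // oner_eq0 -polyC_natr => /(_ isT) /dvdp_leq.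
by rewrite polyC_eq0 kK q_size size_polyC kK leqNgt k1 => /(_ isT).
Qed.

Lemma nontrivial_xi k m :
  (1 < k)%N -> k%:R != 0 :> K -> m = 2%N \/ m = 3%N ->
  nontrivial (alexander_cohomology (laurent_quot (xi K k)) m).
Proof.
have xi_h : xi K k \in pideal (xi K k).
  by apply/asboolP; exists 1; rewrite mul1r.
move=> k1 kK.
apply: (@nontrivial_torus _ _ _ k) => //; last exact: nat_notin_xi.
by rewrite bar_xiE pidealM.
Qed.

Lemma nontrivial_twist N : N%:R != 0 :> K ->
  nontrivial (alexander_cohomology (laurent_quot (t - (1 - t) ^+ 2 * N%:R)) 3).
Proof.
set h := t - _ => NK.
have h_h : h \in pideal h by apply/asboolP; exists 1; rewrite mul1r.
have h_bar : laurent_bar h \in pideal h.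
  have -> : laurent_bar h = tV ^+ 2 * h; last exact: pidealM.
  rewrite /h !(rmorphB, rmorph1, rmorphM, rmorphXn, rmorph_nat) /=.
  by rewrite laurent_bar_t; ring: (laurent_t_mulV K).
have u_h : (1 - N%:R * (tV - 1) * (1 - t)) *: laurent_pi h 1 = 0.
  apply/laurent_pi_eq0.
  have -> : 1 - N%:R * (tV - 1) * (1 - t) = tV * h; last exact: pidealM.
  by rewrite /h; ring: (laurent_t_mulV K).
apply: (nontrivial_of_cycle3 h_bar (twist_cycle3P u_h)).
rewrite twist_cycle3_value // => /laurent_pi_eq0.
(* X - N (1 - X)^2, expanded *)
pose q : {poly K} := (- N%:R) *: 'X^2 + (1 + 2%:R * N%:R) *: 'X - N%:R%:P.
have -> : h = laurent_poly q.
  rewrite /q /h -!mul_polyC !(rmorphB, rmorphD, rmorphN, rmorphM, rmorphXn,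
    rmorph_nat, rmorph1) /=.
  by rewrite laurent_polyX; ring.
have -> : - N%:R * (1 + t) = laurent_poly (- N%:R%:P * (1 + 'X)).
  by rewrite !(rmorphD, rmorphN, rmorphM, rmorph_nat, rmorph1) /= laurent_polyX.
have N0 : - N%:R != 0 :> K by rewrite oppr_eq0.
have q0 : q`_0 != 0 by rewrite /q !coefE /= !mulr0 !add0r.
have q_size : (2 < size q)%N.
  rewrite ltnNge; apply/negP => /leq_sizeP /(_ 2%N (leqnn _)) /eqP.
  by rewrite /q !coefE /= mulr0 mulr1 addr0 subr0 (negbTE N0).
have X1 : size (1 + 'X : {poly K}) = 2%N by rewrite addrC -polyC1 size_XaddC.
move=> /(pideal_dvdp q0) /dvdp_leq.
rewrite -polyCN mul_polyC scaler_eq0 (negbTE N0) size_scale // -size_poly_eq0.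
by rewrite X1; move=> /(_ isT); rewrite leqNgt q_size.
Qed.

End Field.

(** An integer n may be replaced by its residue, because p = 0 in Z_p. *)
Lemma quadratic_relatorE p (n : int) : prime p -> exists N : nat,
  quadratic_relator p n = laurent_t - (1 - laurent_t) ^+ 2 * N%:R
  /\ (p %| N)%N = (p %| n)%Z.
Proof.
move=> p_pr; have p0 : p%:Z != 0 by have := prime_gt0 p_pr; lia.
have NE : `|(n %% p)%Z|%N%:Z = (n %% p)%Z by rewrite gez0_abs ?modz_ge0.
exists `|(n %% p)%Z|%N; split; last first.
  by rewrite [in RHS](divz_eq n p) rpredDl ?dvdz_mull // -NE.
rewrite /quadratic_relator {1}(divz_eq n p) mulrzDr -NE -pmulrn mulr_natr.
suff -> : (1 - laurent_t : laurent 'F_p) ^+ 2 *~ ((n %/ p)%Z * p) = 0.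
  by rewrite add0r.
rewrite mulrzA -pmulrn -mulr_natr -(rmorph_nat (@laurent_poly 'F_p)).
by rewrite -polyC_natr pchar_Fp_0 // rmorph0 mulr0.
Qed.

Theorem proposition4p1 :
  [/\ (forall n m : nat, (0 < n)%N -> m = 2%N \/ m = 3%N ->
         nontrivial (alexander_cohomology
           (laurent_quot (xi 'F_2 (2 ^ n + 1))) m)),
      (forall p n m : nat, prime p -> odd p -> (0 < n)%N -> m = 2%N \/ m = 3%N ->
         nontrivial (alexander_cohomology
           (laurent_quot (xi 'F_p ((p ^ n + 1) %/ 2))) m))
    & (forall (p : nat) (n : int), ~~ (p %| n)%Z ->
            p = 3%N /\ (n %% 3)%Z \in [:: 1; 2]
         \/ p = 5%N /\ (n %% 5)%Z \in [:: 1; 3; 4]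
         \/ p = 7%N /\ (n %% 7)%Z \notin [:: 2; 6]
         \/ p = 11%N /\ (n %% 11)%Z \notin [:: 1; 2; 6; 9]
         \/ p = 13%N /\ (n %% 13)%Z \notin [:: 2; 4; 6; 7; 12] ->
         nontrivial (alexander_cohomology
           (laurent_quot (quadratic_relator p n)) 3))].
Proof.
have natF p k : prime p -> (k%:R != 0 :> 'F_p) = ~~ (p %| k)%N.
  by move=> p_pr; rewrite (dvdn_pcharf (pchar_Fp p_pr)).
split.
- move=> n m n0; apply: nontrivial_xi; first by rewrite addn1 ltnS expn_gt0.
  by case: n n0 => // n _; rewrite natF // dvdn2 addn1 /= oddX.
- move=> p n m p_pr p_odd n0.
  have half2 : ((p ^ n + 1) %/ 2 * 2 = p ^ n + 1)%N.
    by rewrite divnK // dvdn2 addn1 /= oddX p_odd orbT.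
  have p2 : (2 < p)%N by rewrite odd_prime_gt2.
  have pn : (p <= p ^ n)%N by rewrite -{1}(expn1 p) leq_exp2l // ltnW.
  apply: nontrivial_xi; first by lia.
  (* p divides p ^ n, so it cannot divide p ^ n + 1 = 2 k. *)
  rewrite natF //; apply/negP => /(dvdn_mulr 2); rewrite half2.
  rewrite dvdn_addr ?dvdn_exp // dvdn1 => /eqP p1; lia.
- move=> p n pn p_list; have p_pr : prime p.
    by case: p_list => [[-> _]|[[-> _]|[[-> _]|[[-> _]|[-> _]]]]].
  have [N [-> pN]] := quadratic_relatorE n p_pr.
  by apply: nontrivial_twist; rewrite natF // pN.
Qed.
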